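(* Let $G$ be a graph on $n$ vertices and let $\Gamma$ be an abelian group with $|\Gamma|=2^k n$, where $k\ge 2$ and $n=2^s(2t+1)$ for some non-negative integers $s$ and $t$. Let $H$ be a balanced distance magic graph on $2^k$ vertices. (i) If there exists a constant $m\in\mathbb{N}$ such that $\deg_G(u)\equiv m \pmod{2^{k+s-1}}$ for all $u\in V(G)$, then $G\circ H$ is $\Gamma$-distance magic. (ii) If there exists a constant $m\in\mathbb{N}$ such that $\deg_G(u)\equiv m \pmod{2^{k+s}}$ for all $u\in V(G)$, then $G\times H$ is $\Gamma$-distance magic.
   Context: All graphs are finite and simple; all groups are finite additive abelian groups. $N_G(u)$ is the set of vertices adjacent to $u$ in $G$, and $\deg_G(u)=|N_G(u)|$. For a graph $G$ and an abelian group $\Gamma$ with $|V(G)|=|\Gamma|$, a $\Gamma$-distance magic labeling of $G$ is a bijection $l:V(G)\to\Gamma$ for which there is an element $\mu_0\in\Gamma$ such that $w_G(u)=\sum_{v\in N_G(u)}l(v)=\mu_0$ for every $u\in V(G)$; $G$ is $\Gamma$-distance magic if it admits such a labeling. The lexicographic product $G\circ H$ and the direct product $G\times H$ both have vertex set $V(G)\times V(H)$; $(g,h)$ and $(g',h')$ are adjacent in $G\circ H$ iff $g$ is adjacent to $g'$ in $G$, or $g=g'$ and $h$ is adjacent to $h'$ in $H$; they are adjacent in $G\times H$ iff $g$ is adjacent to $g'$ in $G$ and $h$ is adjacent to $h'$ in $H$. A graph $H$ is a balanced distance magic graph if $H$ is regular and its vertex set can be written as $\{v_i,v_i' : 1\le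 i\le |V(H)|/2\}$ (all these vertices being distinct) with $N_H(v_i)=N_H(v_i')$ for every $i$. *)

(* Defs.v *)
From HB Require Import structures.
From mathcomp Require Import all_boot all_algebra.

Set Implicit Arguments.
Unset Strict Implicit.
Unset Printing Implicit Defensive.

Import GRing.Theory.

Record sgraph := SGraph {
  vertex :> finType;
  adj : rel vertex;
  adj_sym : symmetric adj;
  adj_irrefl : irreflexive adj
}.

Definition nbr (G : sgraph) (u : G) : {set G} := [set v | adj u v].

Definition deg (G : sgraph) (u : G) : nat := #|nbr u|.

Definition weight (G : sgraph) (Gam : finZmodType) (l : G -> Gam) (u : G) : Gam :=
  (\sum_(v in nbr u) l v)%R.

(* The condition #|G| = #|Gam| is implied by the bijectivity of l. *)
Definition distance_magic_labeling (G : sgraph) (Gam : finZmodType)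
    (l : G -> Gam) : Prop :=
  bijective l /\ exists mu0 : Gam, forall u : G, weight l u = mu0.

Definition distance_magic (G : sgraph) (Gam : finZmodType) : Prop :=
  exists l : G -> Gam, distance_magic_labeling l.

Definition lex_adj (G H : sgraph) : rel (G * H) :=
  fun x y => adj x.1 y.1 || ((x.1 == y.1) && adj x.2 y.2).

Lemma lex_adj_sym (G H : sgraph) : symmetric (@lex_adj G H).
Proof. by move=> x y; rewrite /lex_adj adj_sym eq_sym (adj_sym x.2). Qed.

Lemma lex_adj_irrefl (G H : sgraph) : irreflexive (@lex_adj G H).
Proof. by move=> x; rewrite /lex_adj !adj_irrefl andbF. Qed.

Definition lex_product (G H : sgraph) : sgraph :=
  SGraph (@lex_adj_sym G H) (@lex_adj_irrefl G H).

Definition direct_adj (G H : sgraph) : rel (G * H) :=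
  fun x y => adj x.1 y.1 && adj x.2 y.2.

Lemma direct_adj_sym (G H : sgraph) : symmetric (@direct_adj G H).
Proof. by move=> x y; rewrite /direct_adj adj_sym (adj_sym x.2). Qed.

Lemma direct_adj_irrefl (G H : sgraph) : irreflexive (@direct_adj G H).
Proof. by move=> x; rewrite /direct_adj adj_irrefl. Qed.

Definition direct_product (G H : sgraph) : sgraph :=
  SGraph (@direct_adj_sym G H) (@direct_adj_irrefl G H).

Definition regular (G : sgraph) : Prop :=
  exists r : nat, forall u : G, deg u = r.

(* When #|H| is odd, #|H|./2 rounds down and the covering clause fails. *)
Definition balanced_distance_magic (H : sgraph) : Prop :=
  regular H /\
  exists v v' : 'I_(#|H|./2) -> H,
    [/\ injective v,
        injective v',
        forall i j, v i != v' j,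
        forall x : H, exists i, x = v i \/ x = v' i
      & forall i, nbr (v i) = nbr (v' i)].

(* Main.v *)
(** Since [#|Gam|] is even, doubling is not onto [Gam]; pick [c] outside its
    image and replace it by its odd multiple [(2 * t + 1) c], which is still no
    double and is killed by [2 ^ (k + s)].  Then [x |-> c - x] has no fixed
    point, so [Gam] splits into pairs of sum [c]; give the two elements of a
    pair to twin vertices of a copy of [H].  Every neighbourhood in [H] is a
    union of twin pairs, hence, with [r] the valency of [H], the vertices over
    [g] have weight [(deg g * 2 ^ (k - 1) + r / 2) c] in the lexicographic
    product and [(deg g * (r / 2)) c] in the direct product. *)
Require Import Defs.
From mathcomp Require Import all_boot all_algebra.
From mathcomp Require Import fingroup cyclic pgroup.
From mathcomp Require Import zify.

Set Implicit Arguments.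
Unset Strict Implicit.
Unset Printing Implicit Defensive.

Import GRing.Theory FinRing.Theory.

(** From each orbit of [s], [R] keeps the element that comes first in the enumeration of [T]. The
    preimage of [R] under [s] is then its complement, which forces [R] to be half of [T]. *)
Lemma fpf_involution_transversal (T : finType) (s : T -> T) :
  involutive s -> (forall x, s x != x) ->
  exists2 R : {set T}, #|R| * 2 = #|T| &
    forall x, (s x \in R) = (x \notin R).
Proof.
move=> sK s_fpf; pose R := [set x | enum_rank x < enum_rank (s x)].
have sR x : (s x \in R) = (x \notin R).
  rewrite !inE sK -leqNgt [RHS]leq_eqVlt (inj_eq (@ord_inj _)).
  by rewrite (inj_eq enum_rank_inj) (negbTE (s_fpf x)).
exists R => //; have sRC : s @^-1: R = ~: R by apply/setP=> x; rewrite in_setC inE sR.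
rewrite muln2 -addnn -(cardsC R) -sRC on_card_preimset //.
by exists s => x _; rewrite sK.
Qed.

Lemma fpf_involution_bij (I T : finType) (s : T -> T) :
  involutive s -> (forall x, s x != x) -> #|I| * 2 = #|T| ->
  exists2 f : I * bool -> T, bijective f &
    forall i, f (i, true) = s (f (i, false)).
Proof.
move=> sK s_fpf cardI; have [R cardR sR] := fpf_involution_transversal sK s_fpf.
have IR : #|I| = #|R| by apply/eqP; rewrite -(eqn_pmul2r (isT : 0 < 2)) cardI cardR.
pose e i : T := enum_val (cast_ord IR (enum_rank i)).
have eR i : e i \in R by exact: enum_valP.
have e_inj : injective e.
  by move=> i j /enum_val_inj/cast_ord_inj/enum_rank_inj.
exists (fun p => if p.2 then s (e p.1) else e p.1) => //.
apply: inj_card_bij; last by rewrite card_prod card_bool cardI.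
move=> [i []] [j []] /= eij.
- by rewrite (e_inj i j) //; apply: (can_inj sK).
- by have := sR (e i); rewrite eij !eR.
- by have := sR (e j); rewrite -eij !eR.
- by rewrite (e_inj i j).
Qed.

Lemma mulrn_card (Gam : finZmodType) (x : Gam) : (x *+ #|Gam| = 0)%R.
Proof. by rewrite -zmodXgE -cardsT expg_cardG ?inE. Qed.

(** Cauchy's theorem gives an element of order 2, which doubling sends to 0; so doubling is not
    injective and, [Gam] being finite, not onto. *)
Lemma exists_nondouble (Gam : finZmodType) :
  2 %| #|Gam| -> exists c : Gam, forall x, (x *+ 2)%R != c.
Proof.
rewrite -cardsT => even_Gam.
have [x _ ox] := Cauchy (isT : prime 2) (even_Gam : 2 %| #|[set: Gam]%G|).
have x2 : (x *+ 2 = 0)%R by rewrite -zmodXgE -ox expg_order.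
have x_neq0 : x != 0%R.
  by apply: contra_eq_neq ox => ->; rewrite (order1 Gam).
case: (pickP [pred c : Gam | c \notin (fun x : Gam => (x *+ 2)%R) @: setT]).
  by move=> c cN; exists c => y; apply: contraNneq cN => <-; apply: imset_f.
move=> onto; case/eqP: x_neq0.
have /imset_injP dbl_inj : #|(fun x : Gam => (x *+ 2)%R) @: setT| == #|[set: Gam]|.
  apply/eqP; congr #|pred_of_set _|; apply/setP=> c.
  by rewrite [RHS]inE; apply/negPn; rewrite -[_ \notin _]/([pred c | _] c) onto.
by apply: dbl_inj; rewrite ?inE // x2 mul0rn.
Qed.

Local Open Scope ring_scope.

Lemma exists_nondouble_ann (Gam : finZmodType) (a b : nat) :
  #|Gam| = (2 ^ a.+1 * (2 * b + 1))%N ->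
  exists2 c : Gam, forall x, x *+ 2 != c & c *+ 2 ^ a.+1 = 0.
Proof.
move=> cardGam; have [|c c_ndbl] := @exists_nondouble Gam.
  by rewrite cardGam dvdn_mulr // dvdn_exp.
exists (c *+ (2 * b + 1)) => [x|]; last by rewrite -mulrnA mulnC -cardGam mulrn_card.
(* If [x] were a half of [c *+ (2 * b + 1)], then [x - c *+ b] would be a half of [c]. *)
have := c_ndbl (x - c *+ b).
by rewrite mulrnBl -mulrnA subr_eq addrC -mulrSr addn1 [(b * 2)%N]mulnC.
Qed.

Section TwinPairs.

Variables (H : finType) (m : nat) (v v' : 'I_m -> H).
Hypotheses (v_inj : injective v) (v'_inj : injective v').
Hypotheses (vNv' : forall i j, v i != v' j).
Hypothesis (v_cover : forall x, exists i, x = v i \/ x = v' i).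

Let pair (p : 'I_m * bool) : H := if p.2 then v' p.1 else v p.1.

Lemma twin_pairs_bij : bijective pair.
Proof.
have pair_inj : injective pair.
  move=> [i []] [j []]; rewrite /pair /=.
  - by move/v'_inj->.
  - by move/esym/eqP; rewrite (negbTE (vNv' _ _)).
  - by move/eqP; rewrite (negbTE (vNv' _ _)).
  - by move/v_inj->.
have surj x : exists p, pair p == x.
  have [i [->|->]] := v_cover x; first by exists (i, false).
  by exists (i, true).
exists (fun x => xchoose (surj x)) => [p|x].
  by apply/pair_inj/eqP; exact: (xchooseP (surj (pair p))).
by apply/eqP; exact: (xchooseP (surj x)).
Qed.

(** Here [A] is a union of twin pairs, each contributing [c]; so [#|A|] is even and its half is
    exactly the number of pairs. The lemma serves for all of [H] and for a single neighbourhood. *)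
Lemma sum_twin_pairs (V : nmodType) (F : H -> V) (c : V) (A : {set H}) :
  (forall i, F (v i) + F (v' i) = c) ->
  (forall i, (v i \in A) = (v' i \in A)) ->
  \sum_(h in A) F h = c *+ #|A|./2.
Proof.
move=> F_pair A_pair.
(* The codomain is left general so that the same regrouping by pairs also counts [A], with the
   constant 1 in [nat]. *)
have sumE (W : nmodType) (K : H -> W) :
    \sum_(h in A) K h = \sum_(i | v i \in A) (K (v i) + K (v' i)).
  rewrite (reindex pair (onW_bij _ twin_pairs_bij)) big_mkcond /=.
  rewrite -(pair_bigA _ (fun i b =>
    if pair (i, b) \in A then K (pair (i, b)) else 0)) /=.
  rewrite [RHS]big_mkcond; apply: eq_bigr => i _.
  rewrite big_bool /pair /= -A_pair addrC.
  by case: ifP => // _; rewrite addr0.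
have cardA : #|A| = #|[pred i | v i \in A]|.*2.
  by rewrite -sum1_card (sumE nat) sum_nat_const muln2.
by rewrite sumE (eq_bigr _ (fun i _ => F_pair i)) sumr_const cardA doubleK.
Qed.

End TwinPairs.

Lemma balanced_labeling (G H : sgraph) (Gam : finZmodType) (c : Gam) :
  (#|G| * #|H|)%N = #|Gam| -> (forall x : Gam, x *+ 2 != c) ->
  ~~ odd #|H| -> balanced_distance_magic H ->
  exists2 l : G * H -> Gam, bijective l &
    forall g, \sum_h l (g, h) = c *+ #|H|./2 /\
      forall h, \sum_(h' in nbr h) l (g, h') = c *+ (deg h)./2.
Proof.
move=> cardGam c_ndbl evenH [_ [v [v' [v_inj v'_inj vNv' v_cover v_twin]]]].
(* The pairs [{x, c - x}] of [Gam] are indexed by a vertex of [G], that is a copy of [H], together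
   with a twin pair of [H]. *)
have [|x||f f_bij f_compl] :=
    @fpf_involution_bij (G * 'I_(#|H|./2))%type Gam (fun x => c - x).
- by move=> x; rewrite subKr.
- by rewrite subr_eq -mulr2n eq_sym c_ndbl.
- by rewrite card_prod card_ord -mulnA muln2 even_halfK.
have [q pairK qK] := twin_pairs_bij v_inj v'_inj vNv' v_cover.
(* [q] recovers from a vertex of [H] its twin pair and its place in it, so twins in one copy receive
   labels with sum [c]. *)
pose l (p : G * H) := f ((p.1, (q p.2).1), (q p.2).2).
have l_pair g i : l (g, v i) + l (g, v' i) = c.
  by rewrite /l /= (pairK (i, false)) (pairK (i, true)) /= f_compl addrC subrK.
exists l.
  apply: inj_card_bij; last by rewrite card_prod cardGam.
  move=> [g h] [g' h'] /(bij_inj f_bij) [-> eq1 eq2]; congr pair.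
  by apply: (can_inj qK); rewrite [LHS]surjective_pairing eq1 eq2 -surjective_pairing.
have sum_l g A := sum_twin_pairs v_inj v'_inj vNv' v_cover
  (F := fun h => l (g, h)) (A := A) (l_pair g).
move=> g; split=> [|h].
  rewrite -cardsT -(sum_l g) => [|i]; last by rewrite !inE.
  by apply: eq_bigl => h; rewrite inE.
(* Twins have the same neighbours, so by symmetry of adjacency [nbr h] contains both of them or
   neither. *)
by apply: sum_l => i; have /setP/(_ h) := v_twin i;
  rewrite !inE ![adj h _]adj_sym.
Qed.

Lemma weight_lex (G H : sgraph) (Gam : finZmodType) (l : G * H -> Gam) g h :
  @weight (lex_product G H) Gam l (g, h) =
  \sum_(g' in nbr g) \sum_h' l (g', h') + \sum_(h' in nbr h) l (g, h').
Proof.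
rewrite /weight (bigID (fun p : G * H => p.1 == g)) [LHS]addrC; congr (_ + _) => /=.
  rewrite pair_big_dep /=; apply: eq_big => [[g' h']|[g' h'] //].
  rewrite !inE /= /lex_adj /= eq_sym; case: eqP => [->|_] /=; last by rewrite orbF !andbT.
  by rewrite adj_irrefl andbF.
(* The sum within the copy over [g] is turned into a double sum whose first index is restricted to
   [g], to match a sum over pairs. *)
rewrite -[RHS](big_pred1_eq +%R g (fun g' => \sum_(h' in nbr h) l (g', h'))).
rewrite pair_big /=; apply: eq_big => [[g' h']|[g' h'] //].
rewrite !inE /= /lex_adj /= eq_sym; case: eqP => [->|_] /=; last by rewrite andbF.
by rewrite adj_irrefl andbT.
Qed.

Lemma weight_direct (G H : sgraph) (Gam : finZmodType) (l : G * H -> Gam) g h :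
  @weight (direct_product G H) Gam l (g, h) =
  \sum_(g' in nbr g) \sum_(h' in nbr h) l (g', h').
Proof.
by rewrite /weight pair_big /=; apply: eq_big => [[g' h']|[g' h'] //]; rewrite !inE.
Qed.

Lemma mulrn_mod_ann (V : nmodType) (c : V) (d a b : nat) :
  c *+ d = 0 -> a = b %[mod d] -> c *+ a = c *+ b.
Proof.
move=> cd0 ab; rewrite (divn_eq a d) (divn_eq b d) ab.
by rewrite !mulrnDr !(mulnC _ d) !mulrnA cd0 !mul0rn.
Qed.

Local Close Scope ring_scope.

Theorem theorem3p2 (G H : sgraph) (Gam : finZmodType) (n k s t : nat)
    (cardG : #|G| = n)
    (cardGam : #|Gam| = 2 ^ k * n)
    (k_ge2 : 2 <= k)
    (n_eq : n = 2 ^ s * (2 * t + 1))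
    (cardH : #|H| = 2 ^ k)
    (balH : balanced_distance_magic H) :
  ((exists m : nat, forall u : G, deg u = m %[mod 2 ^ (k + s - 1)]) ->
     distance_magic (lex_product G H) Gam) /\
  ((exists m : nat, forall u : G, deg u = m %[mod 2 ^ (k + s)]) ->
     distance_magic (direct_product G H) Gam).
Proof.
have cardGam' : #|Gam| = 2 ^ (k + s).-1.+1 * (2 * t + 1).
  by rewrite cardGam n_eq mulnA -expnD prednK // addn_gt0 (ltnW k_ge2).
have [c c_ndbl c_ann] := exists_nondouble_ann cardGam'.
rewrite prednK ?addn_gt0 ?(ltnW k_ge2) // in c_ann.
have evenH : ~~ odd #|H| by rewrite cardH oddX /= orbF -lt0n ltnW.
have [|l l_bij sum_l] := balanced_labeling (G := G) _ c_ndbl evenH balH.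
  by rewrite cardG cardH cardGam mulnC.
have [[r degH] _] := balH.
have halfH : #|H|./2 = 2 ^ k.-1.
  by rewrite cardH -(prednK (ltnW k_ge2)) expnS mul2n doubleK.
split=> -[m degG]; exists l; split=> //.
- exists (c *+ (2 ^ k.-1 * m) + c *+ r./2)%R => -[g h].
  rewrite weight_lex (sum_l g).2 degH; congr (_ + _)%R.
  rewrite (eq_bigr _ (fun g' _ => (sum_l g').1)) halfH sumr_const -mulrnA.
  (* The factor [2 ^ k.-1] lets the weaker modulus suffice: the product is [2 ^ (2 * k + s - 2)], a
     multiple of [2 ^ (k + s)] because [k >= 2]. *)
  apply: mulrn_mod_ann (_ : c *+ (2 ^ k.-1 * 2 ^ (k + s - 1)) = 0)%R _; last first.
    by rewrite -!muln_modr degG.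
  have -> : 2 ^ k.-1 * 2 ^ (k + s - 1) = 2 ^ (k + s) * 2 ^ (k - 2).
    by rewrite -!expnD; congr (_ ^ _); lia.
  by rewrite mulrnA c_ann mul0rn.
- exists (c *+ r./2 *+ m)%R => -[g h].
  rewrite weight_direct (eq_bigr _ (fun g' _ => (sum_l g').2 h)) degH sumr_const.
  (* Now the degree multiplies [c *+ r./2], and [r./2] may be odd, so the annihilation comes from
     the full modulus [2 ^ (k + s)]. *)
  by apply: mulrn_mod_ann (degG g); rewrite mulrnAC c_ann mul0rn.
Qed.
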